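(* Let $r,s$ be positive integers. An $r$-colored partition is a finite multiset of colored parts $j_c$ ($j\ge1$, $c\in\{1,\dots,r\}$). A colored overpartition of $n$ is a pair $(\lambda,\mu)$ where $\lambda$ is an $r$-colored partition of some $m$ and $\mu$ is an $s$-colored partition of $n-m$ into distinct parts (a finite set of colored parts $j_c$, $c\in\{1,\dots,s\}$, each colored part at most once), $0\le m\le n$. A colored odd-overlined partition of $n$ is a pair $(\lambda,\nu)$ where $\lambda$ is an $r$-colored partition of some $m$ and $\nu$ is an $s$-colored partition of $n-m$ into odd parts (a finite multiset of colored parts $j_c$, $j$ odd, $c\in\{1,\dots,s\}$). Define, for positive integers $k,n$: - $F_k(n)$: the total number of parts of size $k$ in the component $\lambda$, summed over all colored overpartitions $(\lambda,\mu)$ of $n$; - $G_k(n)$: the total number of distinct colored parts of $\lambda$ occurring at least $k$ times in $\lambda$, summed over all colored overpartitions $(\lambda,\mu)$ of $n$; - $F^d_k(n)$: the total number of parts of size $k$ in the component $\mu$, summed over all colored overpartitions $(\lambda,\mu)$ of $n$; - $F^o_k(n)$: the total number of parts of size $k$ in the component $\nu$, summed over all colored odd-overlined partitions $(\lambda,\nu)$ of $n$; - $G^o_k(n)$: the total number of distinct colored parts of $\nu$ occurring at least $k$ times in $\nu$, summed over all colored odd-overlined partitions $(\lambda,\nu)$ of $n$; with $G^o_k(m)=0$ for $m\le0$. Then for all $n=1,2,\dots$: $F_k(n)=G_k(n)$ for $k=1,2,3,\dots$; $F^d_k(n)=G^o_k(n)-G^o_k(n-k)$ for $k=1,2,3,\dots$;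 $F^o_k(n)=G^o_k(n)+G^o_k(n-k)$ for $k=1,3,5,\dots$.
   Context: Both colored overpartitions and colored odd-overlined partitions of $n$ are counted by the coefficient of $q^n$ in $\prod_{k\ge1}\frac{(1+q^k)^s}{(1-q^k)^r}=\prod_{k\ge1}\frac{1}{(1-q^k)^r(1-q^{2k-1})^s}$. *)

(* Defs.v *)
From mathcomp Require Import all_boot all_order all_algebra.
From mathcomp Require Import finmap multiset.
From mathcomp Require Import boolp classical_sets functions cardinality fsbigop.

Set Implicit Arguments.
Unset Strict Implicit.
Unset Printing Implicit Defensive.

Local Open Scope classical_set_scope.
Local Open Scope fset_scope.
Local Open Scope mset_scope.
Local Open Scope nat_scope.

(* [(j, i)] is the part of size [j] and color [i]; colors are numbered from 0,
   and [0 < j] is required in the predicates below. *)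
Definition cpart (r : nat) : choiceType := (nat * 'I_r)%type.

Definition colored_partition (r m : nat) (la : {mset cpart r}) : Prop :=
  (forall x, x \in la -> 0 < x.1) /\ \sum_(x <- la) x.1 = m.

Definition colored_distinct_partition (s m : nat) (mu : {fset cpart s}) : Prop :=
  (forall x, x \in mu -> 0 < x.1) /\ \sum_(x <- mu) x.1 = m.

Definition colored_odd_partition (s m : nat) (nu : {mset cpart s}) : Prop :=
  (forall x, x \in nu -> odd x.1) /\ \sum_(x <- nu) x.1 = m.

Definition colored_overpartitions (r s n : nat) :
    set ({mset cpart r} * {fset cpart s}) :=
  [set p | exists m, [/\ m <= n, colored_partition m p.1
                       & colored_distinct_partition (n - m) p.2]].

Definition colored_odd_overlined_partitions (r s n : nat) :
    set ({mset cpart r} * {mset cpart s}) :=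
  [set p | exists m, [/\ m <= n, colored_partition m p.1
                       & colored_odd_partition (n - m) p.2]].

Arguments colored_overpartitions : clear implicits.
Arguments colored_odd_overlined_partitions : clear implicits.

Definition parts_of_size (r k : nat) (la : {mset cpart r}) : nat :=
  count (fun x => x.1 == k) la.

Definition distinct_parts_of_size (s k : nat) (mu : {fset cpart s}) : nat :=
  count (fun x => x.1 == k) mu.

Definition parts_repeated (r k : nat) (la : {mset cpart r}) : nat :=
  #|` [fset x in finsupp la | k <= la x] |.

(* A sum over [\in] is 0 by convention when its support is infinite; this never
   happens below, by [finite_colored_overpartitions] and
   [finite_colored_odd_overlined_partitions]. *)
Definition Fk (r s k n : nat) : nat :=
  \big[addn/0]_(p \in colored_overpartitions r s n) parts_of_size k p.1.

Definition Gk (r s k n : nat) : nat :=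
  \big[addn/0]_(p \in colored_overpartitions r s n) parts_repeated k p.1.

Definition Fdk (r s k n : nat) : nat :=
  \big[addn/0]_(p \in colored_overpartitions r s n) distinct_parts_of_size k p.2.

Definition Fok (r s k n : nat) : nat :=
  \big[addn/0]_(p \in colored_odd_overlined_partitions r s n)
     parts_of_size k p.2.

(* Defined on [int] so that [Gok r s k (n - k)] is meaningful for [n <= k]. *)
Definition Gok (r s k : nat) (m : int) : nat :=
  if m is Posz n.+1 then
    \big[addn/0]_(p \in colored_odd_overlined_partitions r s n.+1)
       parts_repeated k p.2
  else 0.

Lemma weight_mset_ge (r m : nat) (la : {mset cpart r}) (x : cpart r) :
  colored_partition m la -> x \in la -> x.1 <= m /\ la x <= m.
Proof.
move=> [pos <-] xla; have x0 := pos _ xla.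
have xs : x \in finsupp la by rewrite msuppE.
rewrite sum_mset (big_fsetD1 _ xs) /=.
have lx0 : 0 < la x by rewrite -in_mset.
split; apply: leq_trans (leq_addr _ _).
  exact: leq_pmull.
exact: leq_pmulr.
Qed.

Lemma finite_colored_partition (r n : nat) :
  finite_set
    [set la : {mset cpart r} | exists2 m, m <= n & colored_partition m la].
Proof.
pose box : {fset cpart r} :=
    [fset x in [seq ((j, i) : cpart r) | j <- iota 0 n.+1, i <- enum 'I_r]].
have boxE x : (x \in box) = (x.1 < n.+1).
  rewrite in_fset; apply/allpairsP/idP => [[[j i] [jn _ ->]]|xn].
    by move: jn; rewrite mem_iota.
  by exists (x.1, x.2); rewrite mem_iota mem_enum -surjective_pairing.
pose mk (f : {ffun 'I_n.+1 * 'I_r -> 'I_n.+1}) : {mset cpart r} :=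
  [mset[msetn_key] x in box => f (inord x.1, x.2) : nat].
apply: (@sub_finite_set _ _ (mk @` [set: {ffun 'I_n.+1 * 'I_r -> 'I_n.+1}]));
  last exact/finite_image/finite_finset.
move=> la /= [m mn lam].
exists [ffun p : 'I_n.+1 * 'I_r => inord (la (p.1 : nat, p.2))] => //; apply/fsfunP => x.
rewrite /mk fsfunE /=; have [xla|xla] := boolP (x \in la).
  have [x1 lx] := weight_mset_ge lam xla.
  have x1n : x.1 < n.+1 by rewrite ltnS (leq_trans x1).
  rewrite boxE x1n.
  by rewrite ffunE /= !inordK ?ltnS -?surjective_pairing // (leq_trans lx).
have lx0 : la x = 0 by apply/eqP; rewrite -leqn0 leqNgt -in_mset.
rewrite lx0 boxE; case: ifP => // xn.
by rewrite ffunE /= !inordK -?surjective_pairing ?lx0 // inordK.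
Qed.

Lemma colored_distinct_partition_mset (s m : nat) (mu : {fset cpart s}) :
  colored_distinct_partition m mu ->
  colored_partition m (seq_mset mu).
Proof.
move=> [pos <-]; split=> [x|]; last first.
  by apply: perm_big; exact: perm_eq_seq_mset.
by rewrite in_mset mset_seqE -has_count has_pred1; apply: pos.
Qed.

Lemma finite_colored_overpartitions (r s n : nat) :
  finite_set (colored_overpartitions r s n).
Proof.
pose A := [set la : {mset cpart r} | exists2 m, m <= n & colored_partition m la].
pose B := [set la : {mset cpart s} | exists2 m, m <= n & colored_partition m la].
apply: (@sub_finite_set _ _
  (A `*` ((fun la : {mset cpart s} => finsupp la) @` B))).
  case=> la mu [m [mn h1 h2]]; split; first by exists m.
  exists (seq_mset mu : {mset cpart s}).
    by exists (n - m); [exact: leq_subr | exact: colored_distinct_partition_mset].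
  apply/fsetP => x.
  by rewrite msuppE in_mset mset_seqE -has_count has_pred1.
apply: finite_setX; first exact: finite_colored_partition.
exact/finite_image/finite_colored_partition.
Qed.

Lemma finite_colored_odd_overlined_partitions (r s n : nat) :
  finite_set (colored_odd_overlined_partitions r s n).
Proof.
pose A := [set la : {mset cpart r} | exists2 m, m <= n & colored_partition m la].
pose B := [set la : {mset cpart s} | exists2 m, m <= n & colored_partition m la].
apply: (@sub_finite_set _ _ (A `*` B)); last first.
  by apply: finite_setX; exact: finite_colored_partition.
case=> la nu [m [mn h1 [odds h2]]]; split; first by exists m.
exists (n - m); first exact: leq_subr.
by split=> // x /odds; exact: odd_gt0.
Qed.

(* Main.v *)
(* Removing [i] copies of the colored part [(k, c)] shows that, among the pairs of
   total weight [n], as many have [(k, c)] at least [i] times in their multiset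
   component as there are pairs of weight [n - i k].  Summing over [i], or over
   the part, expresses F_k, G_k, F^o_k and G^o_k through P(n - i k), where P is
   the number of pairs of the relevant kind.  For the distinct component,
   removing [(k, c)] gives M(n) + M(n - k) = P(n - k) for the number M of pairs
   containing [(k, c)], so F^d_k is an alternating sum of the P(n - i k).
   It remains that both kinds of pairs are equinumerous; this follows by
   induction on n from n P(n) = (total weight of all pairs), since both sides of
   the resulting recurrence agree by a divisor-sum identity. *)
Require Import Defs.
From mathcomp Require Import all_boot all_order all_algebra.
From mathcomp Require Import finmap multiset.
From mathcomp Require Import boolp classical_sets functions cardinality fsbigop.
From mathcomp Require Import zify ring.

Set Implicit Arguments.
Unset Strict Implicit.
Unset Printing Implicit Defensive.

Local Open Scope classical_set_scope.
Local Open Scope fset_scope.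
Local Open Scope mset_scope.
Local Open Scope nat_scope.

(** * Weights and counts of colored parts *)

Definition weight (r : nat) (l : seq (cpart r)) : nat := \sum_(x <- l) x.1.

Lemma sum_eq_ord (N j : nat) (F : nat -> nat) :
  j < N -> \sum_(i < N) (j == i) * F i = F j.
Proof.
move=> jN; rewrite (bigD1 (Ordinal jN)) //= eqxx mul1n big1 ?addn0 // => i.
by rewrite -val_eqE eq_sym /= => /negbTE ->.
Qed.

(** Layer-cake form of a multiplicity: it turns [p.1 x] into indicators of threshold events, each of
    which can be counted by removing copies of [x]. *)
Lemma sum_leq_ord (N j : nat) : j <= N -> \sum_(i < N) (i < j) = j.
Proof.
elim: N j => [|N IH] j jN; first by rewrite big_ord0; lia.
rewrite big_ord_recr /=; case: (ltnP N j) => Nj.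
  have -> : j = N.+1 by lia.
  rewrite (eq_bigr (fun i : 'I_N => (i < N : nat))) ?IH ?addn1 // => i _.
  by have := ltn_ord i; lia.
by rewrite addn0 IH.
Qed.

Lemma count_size_color (r k : nat) (l : seq (cpart r)) :
  count (fun x => x.1 == k) l = \sum_(c < r) count_mem (k, c) l.
Proof.
elim: l => [|[j d] l IH] /=; first by rewrite big1.
rewrite big_split /= -IH; congr addn.
rewrite (bigD1 d) //= big1 ?addn0 => [|i /negbTE id].
  by rewrite xpair_eqE eqxx andbT.
by rewrite xpair_eqE eq_sym [d == i]eq_sym id andbF.
Qed.

Lemma size_count_size (r N : nat) (l : seq (cpart r)) :
  (forall x, x \in l -> 0 < x.1 <= N) ->
  size l = \sum_(j < N) count (fun x => x.1 == j.+1) l.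
Proof.
elim: l => [|x l IH] xl /=; first by rewrite big1.
rewrite big_split /= -IH => [|y yl]; last by rewrite xl // inE yl orbT.
have /andP[x0 xN] := xl x (mem_head _ _).
have xN' : x.1.-1 < N by lia.
rewrite -add1n -[X in X + _](sum_eq_ord (fun=> 1) xN'); congr addn.
by apply: eq_bigr => i _; rewrite muln1 -[x.1 in RHS](prednK x0) eqSS.
Qed.

Lemma weight_count_size (r N : nat) (l : seq (cpart r)) :
  (forall x, x \in l -> x.1 < N) ->
  weight l = \sum_(k < N) k * count (fun x => x.1 == k :> nat) l.
Proof.
rewrite /weight; elim: l => [|x l IH] xl /=.
  by rewrite big_nil big1 // => i; rewrite muln0.
rewrite big_cons IH => [|y yl]; last by rewrite xl // inE yl orbT.
under [RHS]eq_bigr do rewrite mulnDr mulnC.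
rewrite big_split /= (@sum_eq_ord N x.1 (fun k => k)) //; exact/xl/mem_head.
Qed.

Lemma weight_msetD (r : nat) (A B : {mset cpart r}) :
  weight (A `+` B) = weight A + weight B.
Proof.
rewrite /weight -big_cat; apply: perm_big; apply/allP => x _ /=.
by rewrite count_cat !count_mem_mset msetE2.
Qed.

Lemma weight_msetn (r k : nat) (x : cpart r) : weight (msetn k x) = k * x.1.
Proof. by rewrite /weight enum_msetn big_nseq iter_addn_0 mulnC. Qed.

(** Each sum counts the subset where its predicate holds. The maps need to be inverse only between
    these subsets, which suits deletion of a part: it is not injective on all pairs. *)
Lemma fsbig_bool_bij (T U : choiceType) (A : set T) (B : set U)
    (D : T -> bool) (E : U -> bool) (e : T -> U) (e' : U -> T) :
  (forall t, A t -> D t -> [/\ B (e t), E (e t) & e' (e t) = t]) ->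
  (forall u, B u -> E u -> [/\ A (e' u), D (e' u) & e (e' u) = u]) ->
  \big[addn/0]_(u \in B) (E u : nat) = \big[addn/0]_(t \in A) (D t : nat).
Proof.
move=> AB BA.
rewrite -(@fsbig_widen _ _ 0 _ [set u | B u /\ E u]); first last.
- move=> u [/= Bu /not_andP[//|]] /negP /negbTE; rewrite /preimage /= => -> //.
- by move=> u [].
rewrite -(@fsbig_widen _ _ 0 _ [set t | A t /\ D t] A); first last.
- move=> t [/= At /not_andP[//|]] /negP /negbTE; rewrite /preimage /= => -> //.
- by move=> t [].
rewrite (reindex_fsbig e [set t | A t /\ D t]).
  by apply: eq_fsbigr => t /set_mem /= [At Dt]; have [_ -> _] := AB t At Dt; rewrite Dt.
split.
- by move=> t /= [At Dt]; have [? ? _] := AB t At Dt.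
- by move=> t u /set_mem /= [At Dt] /set_mem /= [Au Du] /(congr1 e');
     have [_ _ ->] := AB t At Dt; have [_ _ ->] := AB u Au Du.
- by move=> u /= [Bu Eu]; have [At Dt eu] := BA u Bu Eu; exists (e' u).
Qed.

(** * Counting parts in the multiset component of a pair *)

Section MarkedPartitions.

Variables (q : nat) (a : pred nat) (X : choiceType) (B : set X) (w : X -> nat).
Hypothesis a_gt0 : forall j, a j -> 0 < j.

(** [a] selects the allowed part sizes, and the second component stays abstract, so that the same
    counts serve [la] and [nu]. The weight is an integer so that [n - i * k] is not truncated; a
    negative weight gives the empty set. *)
Definition marked (m : int) : set ({mset cpart q} * X) :=
  [set p : {mset cpart q} * X | [/\ forall x, x \in p.1 -> a x.1, B p.2
             & ((weight p.1 + w p.2)%N%:Z = m)%R]].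

Definition nmarked (m : int) : nat := \big[addn/0]_(p \in marked m) 1.

Hypothesis finite_marked : forall m, finite_set (marked m).

Lemma nmarked_lt0 (m : int) : (m < 0)%R -> nmarked m = 0.
Proof. by move=> m0; apply: fsbig1 => p [_ _]; lia. Qed.

Lemma sum_marked_geq (m : int) (i : nat) (x : cpart q) : a x.1 ->
  \big[addn/0]_(p \in marked m) (i <= p.1 x) = nmarked (m - (i * x.1)%:Z)%R.
Proof.
move=> ax; apply: (@fsbig_bool_bij _ _ _ _ xpredT _
  (fun p => (msetn i x `+` p.1, p.2)) (fun p => (p.1 `\` msetn i x, p.2))).
- move=> [la y] [/= ala By wm] _; split => /=.
  + split=> //= [z|]; last first.
      by rewrite weight_msetD weight_msetn -addnA PoszD wm GRing.addrC GRing.subrK.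
    by rewrite in_msetD in_msetn => /orP[/andP[_ /eqP ->]|/ala].
  + by rewrite msetE2 msetnxx leq_addr.
  + by congr pair; apply/msetP => z; rewrite !msetE2 addKn.
- move=> [la y] [/= ala By wm] ila.
  (* The truncated difference loses nothing because [ila] provides [i] copies of [x]. *)
  have laE : msetn i x `+` (la `\` msetn i x) = la.
    apply/msetP => z; rewrite !msetE2 msetnE; case: eqP => [->|_];
      rewrite ?subnKC ?subn0 ?add0n //.
  split=> //=; last by rewrite laE.
  split=> //= [z|].
    by rewrite in_msetB => zla; apply: ala; rewrite in_mset (leq_trans _ zla).
  move: wm; rewrite -{1}laE weight_msetD weight_msetn -addnA PoszD => <-.
  by rewrite GRing.addrC GRing.addKr.
Qed.

Lemma marked_bound (n : nat) p x : marked n p -> x \in p.1 ->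
  [/\ a x.1, 0 < x.1 <= n & p.1 x <= n].
Proof.
move=> [ap _ wp] xp; have ax := ap x xp; have x0 := a_gt0 ax.
have [] := @weight_mset_ge q (weight p.1) p.1 x _ xp.
  by split=> // y /ap /a_gt0.
by move: wp x0; split=> //; lia.
Qed.

(** The size is fixed and the multiplicity threshold [i.+1] varies. No multiplicity exceeds [n], so
    any [N] from [n] on gives the same sum, and sums with different natural ranges can be
    aligned. *)
Lemma sum_parts_of_size (n N k : nat) : n <= N ->
  \big[addn/0]_(p \in marked n) parts_of_size k p.1
  = a k * (q * \sum_(i < N) nmarked (n%:Z - (i.+1 * k)%:Z)%R).
Proof.
move=> nN; have [ak|nak] := boolP (a k); last first.
  rewrite mul0n fsbig1 // => p mp; apply/eqP; rewrite -leqn0 leqNgt -has_count.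
  by apply/hasPn => x xp; apply: contraNneq nak => <-; have [] := marked_bound mp xp.
rewrite mul1n.
transitivity (\big[addn/0]_(p \in marked n)
    \sum_(c < q) \sum_(i < N) (i < p.1 (k, c))).
  apply: eq_fsbigr => p /set_mem mp; rewrite /parts_of_size count_size_color.
  apply: eq_bigr => c _; rewrite count_mem_mset sum_leq_ord //.
  have [xp|/mset_eq0P -> //] := boolP ((k, c) \in (p.1 : {mset cpart q})).
  by have [_ _ h] := marked_bound mp xp; exact: leq_trans h nN.
transitivity (\sum_(c < q) \sum_(i < N) nmarked (n%:Z - (i.+1 * k)%:Z)%R).
  rewrite fsbig_finite // exchange_big /=; apply: eq_bigr => c _.
  rewrite exchange_big /=; apply: eq_bigr => i _; rewrite -fsbig_finite //.
  exact: (@sum_marked_geq n i.+1 (k, c)).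
by rewrite sum_nat_const card_ord.
Qed.

(** Dual to [sum_parts_of_size]: the threshold [k] is fixed and the size [j.+1] varies. Both remove
    weight [k * j.+1], so they differ only in where [a] is tested. *)
Lemma sum_parts_repeated (n N k : nat) : 0 < k -> n <= N ->
  \big[addn/0]_(p \in marked n) parts_repeated k p.1
  = q * \sum_(j < N) a j.+1 * nmarked (n%:Z - (k * j.+1)%:Z)%R.
Proof.
move=> k0 nN.
transitivity (\big[addn/0]_(p \in marked n)
    \sum_(j < N) \sum_(c < q) a j.+1 * (k <= p.1 (j.+1, c))).
  apply: eq_fsbigr => p /set_mem mp; rewrite /parts_repeated.
  rewrite (@size_count_size _ N) => [|x]; last first.
    rewrite !inE /= msuppE => /andP[xp _].
    have [_ /andP[-> h] _] := marked_bound mp xp; exact: leq_trans h nN.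
  apply: eq_bigr => j _; rewrite count_size_color; apply: eq_bigr => c _.
  rewrite count_uniq_mem ?fset_uniq // !inE /= msuppE in_mset.
  have [ka|ka] := leqP k (p.1 (j.+1, c)); last by rewrite andbF muln0.
  have xp : (j.+1, c) \in (p.1 : {mset cpart q}) by rewrite in_mset (leq_trans k0).
  by have [-> _ _] := marked_bound mp xp; rewrite (leq_trans k0 ka).
rewrite fsbig_finite // exchange_big /= big_distrr; apply: eq_bigr => j _ /=.
rewrite exchange_big /= -[X in X * _](card_ord q) -sum_nat_const.
apply: eq_bigr => c _; rewrite -big_distrr /=.
have [aj|_] := boolP (a j.+1); last by rewrite !mul0n.
by rewrite !mul1n -fsbig_finite // (@sum_marked_geq n k (j.+1, c)).
Qed.

Lemma sum_weight_fst (n N : nat) : n < N ->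
  \big[addn/0]_(p \in marked n) weight (p.1 : {mset cpart q})
  = \sum_(k < N) k * (a k * (q * \sum_(i < N) nmarked (n%:Z - (i.+1 * k)%:Z)%R)).
Proof.
move=> nN.
transitivity (\big[addn/0]_(p \in marked n) \sum_(k < N) k * parts_of_size k p.1).
  apply: eq_fsbigr => p /set_mem mp; apply: weight_count_size => x xp.
  have [_ /andP[_ h] _] := marked_bound mp xp; exact: leq_ltn_trans h nN.
rewrite fsbig_finite // exchange_big /=; apply: eq_bigr => k _.
by rewrite -big_distrr /= -fsbig_finite // (@sum_parts_of_size n N k (ltnW nN)).
Qed.

End MarkedPartitions.

Definition positive_parts (r : nat) (l : seq (cpart r)) : Prop :=
  forall x, x \in l -> 0 < x.1.

Definition odd_parts (r : nat) (l : seq (cpart r)) : Prop :=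
  forall x, x \in l -> odd x.1.

Lemma odd_parts_positive (r : nat) (l : seq (cpart r)) :
  odd_parts l -> positive_parts l.
Proof. by move=> h x /h; exact: odd_gt0. Qed.

Lemma positive_weight0 (r : nat) (l : seq (cpart r)) :
  positive_parts l -> weight l = 0 -> l = [::].
Proof.
case: l => // x l pl; rewrite /weight big_cons.
by have := pl x (mem_head _ _); lia.
Qed.

Lemma enum_mset_nil (K : choiceType) (A : {mset K}) : A = [::] :> seq K -> A = mset0.
Proof. by move=> A0; apply/msetP => x; rewrite -!count_mem_mset A0 enum_mset0. Qed.

(** * Colored overpartitions and the distinct component *)

Section Overpartitions.

Variables r s : nat.

Definition overs : int -> set ({mset cpart r} * {fset cpart s}) :=
  marked (leq 1) (fun mu : {fset cpart s} => positive_parts mu)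
         (fun mu : {fset cpart s} => weight mu).

Definition novers : int -> nat :=
  nmarked r (leq 1) (fun mu : {fset cpart s} => positive_parts mu)
         (fun mu : {fset cpart s} => weight mu).

Lemma colored_overpartitionsE (n : nat) : colored_overpartitions r s n = overs n.
Proof.
apply/seteqP; split=> [[la mu] /= [m [mn [pla wla] [pmu wmu]]]|[la mu] /= [pla pmu [wn]]].
  by split=> //=; rewrite [weight la]wla [weight mu]wmu subnKC.
by exists (weight la); rewrite -wn leq_addr addKn; split.
Qed.

Lemma finite_overs (m : int) : finite_set (overs m).
Proof.
case: m => n.
  by rewrite -colored_overpartitionsE; exact: finite_colored_overpartitions.
by apply: (@sub_finite_set _ _ set0) => // p [_ _].
Qed.

Lemma sum_mem_overs (m : int) (x : cpart s) : 0 < x.1 ->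
  \big[addn/0]_(p \in overs m) (x \in p.2)
  + \big[addn/0]_(p \in overs (m - x.1%:Z)%R) (x \in p.2)
  = novers (m - x.1%:Z)%R.
Proof.
move=> x0.
(* Inserting [x] turns the pairs of the smaller weight that avoid [x] into those of weight [m] that
   contain it. The two sums then split the pairs of the smaller weight by membership of [x]. *)
rewrite (@fsbig_bool_bij _ _ (overs (m - x.1%:Z)%R) (overs m)
  (fun p => x \notin p.2) (fun p => x \in p.2)
  (fun p => (p.1, x |` p.2)%fset) (fun p => (p.1, p.2 `\ x)%fset)).
- rewrite -fsbig_split; last exact: finite_overs.
  by apply: eq_fsbigr => p _; case: (x \in p.2).
- move=> [la mu] [/= pla pmu wm] xmu; split=> /=.
  + split=> //= [z /fset1UP[->|/pmu]//|].
    rewrite /weight big_fsetU1 //= -/(weight mu) addnCA PoszD wm.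
    by rewrite GRing.addrC GRing.subrK.
  + by rewrite fset1U1.
  + by rewrite fsetU1K.
- move=> [la mu] [/= pla pmu wm] xmu; split=> /=.
  + split=> //= [z /fsetD1P[_ /pmu]//|].
    move: wm; rewrite [weight mu]/weight (big_fsetD1 x) //= addnCA PoszD => <-.
    by rewrite GRing.addrC GRing.addKr.
  + by rewrite !inE eqxx.
  + by rewrite fsetD1K.
Qed.

Lemma novers_lt0 (m : int) : (m < 0)%R -> novers m = 0.
Proof. exact: nmarked_lt0. Qed.

(** The alternating terms are grouped in pairs because the odd multiples of [k] will form G^o_k(n)
    and the even ones G^o_k(n - k). *)
Lemma sum_distinct_parts_of_size (n N k : nat) : 0 < k -> n < N ->
  ((\big[addn/0]_(p \in overs n) distinct_parts_of_size k p.2)%:Z =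
   s%:Z * \sum_(i < N) ((novers (n%:Z - (i.*2.+1 * k)%:Z))%:Z
                        - (novers (n%:Z - (i.*2.+2 * k)%:Z))%:Z))%R.
Proof.
move=> k0 nN.
pose M c m := \big[addn/0]_(p \in overs m) ((k, c) \in p.2).
(* The recurrence of [sum_mem_overs] is unrolled two steps at a time, with an explicit remainder. *)
have ME c (j : nat) : ((M c n)%:Z = \sum_(i < j)
    ((novers (n%:Z - (i.*2.+1 * k)%:Z))%:Z - (novers (n%:Z - (i.*2.+2 * k)%:Z))%:Z)
    + (M c (n%:Z - (j.*2 * k)%:Z))%:Z)%R.
  elim: j => [|j IH]; first by rewrite big_ord0 mul0n GRing.subr0 GRing.add0r.
  rewrite big_ord_recr /= IH -GRing.addrA; congr (_ + _)%R.
  have H1 := @sum_mem_overs (n%:Z - (j.*2 * k)%:Z)%R (k, c) k0.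
  have H2 := @sum_mem_overs (n%:Z - (j.*2.+1 * k)%:Z)%R (k, c) k0.
  have E1 : (n%:Z - (j.*2 * k)%:Z - k%:Z = n%:Z - (j.*2.+1 * k)%:Z)%R by lia.
  have E2 : (n%:Z - (j.*2.+1 * k)%:Z - k%:Z = n%:Z - (j.*2.+2 * k)%:Z)%R by lia.
  rewrite [(k, c).1]/= ?E1 ?E2 in H1 H2; rewrite doubleS -H1 -H2 /M !PoszD; ring.
transitivity ((\sum_(c < s) M c n)%:Z)%R.
  congr (Posz _); have fin := @finite_overs n; rewrite fsbig_finite //.
  transitivity (\sum_(c < s) \sum_(p <- fset_set (overs n)) ((k, c) \in p.2 : nat)).
    rewrite exchange_big /=; apply: eq_bigr => p _.
    rewrite /distinct_parts_of_size count_size_color; apply: eq_bigr => c _.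
    by rewrite count_uniq_mem ?fset_uniq.
  by apply: eq_bigr => c _; rewrite /M fsbig_finite.
have E c : ((M c n)%:Z = \sum_(i < N)
    ((novers (n%:Z - (i.*2.+1 * k)%:Z))%:Z - (novers (n%:Z - (i.*2.+2 * k)%:Z))%:Z))%R.
  (* After [N] double steps the remainder concerns pairs of negative weight, so it is 0. *)
  rewrite (ME c N) [M c (n%:Z - _)%R]fsbig1 ?GRing.addr0 // => p [_ _].
  have : (N.*2 * k > n)%N by nia.
  by lia.
have -> F : ((\sum_(c < s) F c)%N%:Z = \sum_(c < s) (F c)%:Z)%R.
  exact: (big_morph Posz PoszD).
rewrite (eq_bigr _ (fun c _ => E c)).
by rewrite GRing.sumr_const card_ord -GRing.mulr_natl natz.
Qed.

Lemma novers0 : novers 0%R = 1.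
Proof.
rewrite /novers /nmarked.
have -> : marked (leq 1) (fun mu : {fset cpart s} => positive_parts mu)
      (fun mu => weight mu) 0%R = [set ((mset0 : {mset cpart r}), fset0)].
  apply/seteqP; split=> [[la mu] /= [pla pmu w0]|_ ->]; last first.
    split=> /= [x|x|]; [by rewrite in_mset0 | by rewrite inE |].
    by rewrite /weight !enum_mset0 !big_nil.
  case: w0 => /eqP; rewrite addn_eq0 => /andP[/eqP wla /eqP wmu].
  have -> : la = mset0 := enum_mset_nil (positive_weight0 pla wla).
  congr pair; apply/fsetP => x; rewrite inE.
  have mu0 : enum_fset mu = [::] := positive_weight0 pmu wmu.
  by have -> : (x \in mu) = (x \in enum_fset mu) by []; rewrite mu0.
by rewrite fsbig_set1.
Qed.

End Overpartitions.

(** * Colored odd-overlined partitions *)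

Section OddOverlined.

Variables r s : nat.

Definition odds : int -> set ({mset cpart r} * {mset cpart s}) :=
  marked (leq 1) (fun nu : {mset cpart s} => odd_parts nu)
         (fun nu : {mset cpart s} => weight nu).

Definition nodds : int -> nat :=
  nmarked r (leq 1) (fun nu : {mset cpart s} => odd_parts nu)
         (fun nu : {mset cpart s} => weight nu).

(* The components are exchanged because the lemmas on [marked] concern the first
   one. *)
Definition swapped_odds : int -> set ({mset cpart s} * {mset cpart r}) :=
  marked odd (fun la : {mset cpart r} => positive_parts la)
         (fun la : {mset cpart r} => weight la).

Lemma colored_odd_overlined_partitionsE (n : nat) :
  colored_odd_overlined_partitions r s n = odds n.
Proof.
apply/seteqP; split=> [[la mu] /= [m [mn [pla wla] [pmu wmu]]]|[la mu] /= [pla pmu [wn]]].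
  by split=> //=; rewrite [weight la]wla [weight mu]wmu subnKC.
by exists (weight la); rewrite -wn leq_addr addKn; split.
Qed.

Lemma finite_odds (m : int) : finite_set (odds m).
Proof.
case: m => n; last by apply: (@sub_finite_set _ _ set0) => // p [_ _].
rewrite -colored_odd_overlined_partitionsE.
exact: finite_colored_odd_overlined_partitions.
Qed.

Lemma swap_odds_bij (m : int) : set_bij (odds m) (swapped_odds m) (fun p => (p.2, p.1)).
Proof.
split=> [[la nu] [/= pla pnu wm]|[la nu] [la' nu'] _ _ [-> ->] //|
         [nu la] [/= pnu pla wm]].
  by split=> //=; rewrite addnC.
by exists (la, nu) => //; split=> //=; rewrite addnC.
Qed.

Lemma finite_swapped_odds (m : int) : finite_set (swapped_odds m).
Proof.
have [_ _ /sub_finite_set] := swap_odds_bij m; apply.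
exact/finite_image/finite_odds.
Qed.

Lemma sum_odds_snd (m : int) (F : {mset cpart s} -> nat) :
  \big[addn/0]_(p \in odds m) F p.2 = \big[addn/0]_(p \in swapped_odds m) F p.1.
Proof. by rewrite (reindex_fsbig _ _ _ _ (swap_odds_bij m)). Qed.

Lemma nswapped_odds (m : int) :
  nmarked s odd (fun la : {mset cpart r} => positive_parts la)
         (fun la : {mset cpart r} => weight la) m = nodds m.
Proof. exact: (esym (sum_odds_snd m (fun=> 1))). Qed.

Lemma nodds_lt0 (m : int) : (m < 0)%R -> nodds m = 0.
Proof. exact: nmarked_lt0. Qed.

Lemma nodds0 : nodds 0%R = 1.
Proof.
rewrite /nodds /nmarked.
have -> : marked (leq 1) (fun nu : {mset cpart s} => odd_parts nu)
      (fun nu : {mset cpart s} => weight nu) 0%R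
    = [set ((mset0 : {mset cpart r}), mset0)].
  apply/seteqP; split=> [[la nu] /= [pla /odd_parts_positive pnu w0]|_ ->]; last first.
    split=> /= [x|x|]; [by rewrite in_mset0 | by rewrite enum_mset0 |].
    by rewrite /weight !enum_mset0 !big_nil.
  case: w0 => /eqP; rewrite addn_eq0 => /andP[/eqP wla /eqP wnu].
  have -> : la = mset0 := enum_mset_nil (positive_weight0 pla wla).
  by have -> : nu = mset0 := enum_mset_nil (positive_weight0 pnu wnu).
by rewrite fsbig_set1.
Qed.

End OddOverlined.

(** * The divisor-sum identity *)

Local Open Scope ring_scope.
Import GRing.Theory.

Lemma big_ord_double (V : nmodType) (N : nat) (F : nat -> V) :
  \sum_(i < N.*2) F i = \sum_(i < N) (F i.*2 + F i.*2.+1).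
Proof.
elim: N => [|N IH]; first by rewrite !big_ord0.
by rewrite doubleS !big_ord_recr /= IH addrA.
Qed.

Lemma big_ord_truncate (V : nmodType) (M N : nat) (F : nat -> V) :
  (N <= M)%N -> (forall i, (N <= i)%N -> F i = 0) ->
  \sum_(i < M) F i = \sum_(i < N) F i.
Proof.
move=> NM F0; rewrite -(subnKC NM) big_split_ord /= [X in _ + X]big1 ?addr0 // => i _.
by rewrite F0 ?leq_addr.
Qed.

(* For [f] the indicator of [m], this says that
   [\sum_(d %| m) (-1) ^ (m / d - 1) * d] is the sum of the odd divisors of [m]. *)
Lemma alternating_divisor_sum (f : nat -> int) (N : nat) :
  (forall m, (N <= m)%N -> f m = 0) ->
  \sum_(k < N.*2) k%:Z * \sum_(i < N) (f (i.*2.+1 * k)%N - f (i.*2.+2 * k)%N)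
  = \sum_(k < N.*2) k%:Z * ((odd k)%:Z * \sum_(i < N.*2) f (i.+1 * k)%N).
Proof.
move=> f0.
pose S k := \sum_(i < N.*2) f (i.+1 * k)%N.
pose g k i := k%:Z * f (i.+1 * k.*2)%N.
(* An alternating sum is the full sum minus twice its even-multiple terms, which are the [g k i]. *)
transitivity (\sum_(k < N.*2) (k%:Z * S k - (\sum_(i < N) g k i) *+ 2)).
  apply: eq_bigr => k _; rewrite /S (big_ord_double N (fun i => f (i.+1 * k)%N)).
  rewrite -mulr_sumr -mulrnAr -mulrBr.
  congr (_ * _); rewrite -sumrMnl -sumrB; apply: eq_bigr => i _.
  have -> : (i.+1 * k.*2 = i.*2.+2 * k)%N by lia.
  ring.
transitivity (\sum_(k < N.*2) (k%:Z * S k - (~~ odd k)%:Z * (k%:Z * S k))); last first.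
  by apply: eq_bigr => k _; rewrite -/(S k); case: (odd k); rewrite /=; ring.
rewrite !sumrB; congr (_ - _).
(* Only even sizes [k.*2] remain on the right, and their factor 2 matches the doubled [g]. The
   ranges differ only by terms where [f] vanishes or [k = 0]. *)
rewrite (big_ord_double _ (fun k => (~~ odd k)%:Z * (k%:Z * S k))) sumrMnl.
rewrite (big_ord_truncate (N := N) (F := fun k => \sum_(i < N) g k i))
  => [||k Nk]; last 2 first.
- by rewrite -addnn leq_addr.
- by rewrite big1 // => i _; rewrite /g f0 ?mulr0 //; nia.
rewrite -sumrMnl; apply: eq_bigr => k _.
rewrite /= odd_double /= mul1r mul0r addr0 /S mulr_sumr.
rewrite -sumrMnl -(big_ord_truncate (M := N.*2) (F := fun i => g k i *+ 2)).
- by apply: eq_bigr => i _; rewrite /g -mulrnAl; congr (_ * _); lia.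
- by rewrite -addnn leq_addr.
- move=> i Ni; rewrite /g; case: (posnP k) => [->|k0]; first by rewrite mul0r mul0rn.
  by rewrite f0 ?mulr0 ?mul0rn //; nia.
Qed.

Lemma Posz_sum (N : nat) (F : 'I_N -> nat) :
  ((\sum_(k < N) F k)%N)%:Z = \sum_(k < N) (F k)%:Z.
Proof. exact: (big_morph Posz PoszD). Qed.

Lemma leq1_gt0 (j : nat) : (leq 1 j -> 0 < j)%N. Proof. by []. Qed.

(** * Weight recurrences and equinumerosity *)

Section Euler.

Variables r s : nat.

(** The total weight of all pairs is computed by part size in each component. Sizes run below [N.*2]
    to fit [alternating_divisor_sum]. *)
Lemma novers_weight (n N : nat) : (n < N)%N ->
  n%:Z * (novers r s n)%:Z = \sum_(k < N.*2) (k%:Z *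
    ((0 < k)%:Z * (r%:Z * \sum_(i < N.*2) (novers r s (n%:Z - (i.+1 * k)%:Z))%:Z)
     + s%:Z * \sum_(i < N) ((novers r s (n%:Z - (i.*2.+1 * k)%:Z))%:Z
                           - (novers r s (n%:Z - (i.*2.+2 * k)%:Z))%:Z))).
Proof.
move=> nN; have nN2 : (n < N.*2)%N by lia.
have fin := @finite_overs r s n.
transitivity (((\big[addn/0]_(p \in @overs r s n) weight (p.1 : {mset cpart r}))
   + (\big[addn/0]_(p \in @overs r s n) weight (enum_fset p.2)))%N%:Z).
  rewrite -fsbig_split // -PoszM; congr (Posz _).
  rewrite /novers /nmarked -[LHS]/(muln n _) fsbig_distrr //.
  by apply: eq_fsbigr => p /set_mem [_ _ [<-]]; rewrite /= muln1.
rewrite PoszD (sum_weight_fst leq1_gt0 (@finite_overs r s) nN2).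
have -> : \big[addn/0]_(p \in @overs r s n) weight (enum_fset p.2)
   = (\sum_(k < N.*2)
        k * \big[addn/0]_(p \in @overs r s n) distinct_parts_of_size k p.2)%N.
  transitivity (\big[addn/0]_(p \in @overs r s n)
      (\sum_(k < N.*2) k * distinct_parts_of_size k p.2)%N).
    apply: eq_fsbigr => p /set_mem [_ _ [wn]]; apply: weight_count_size => x xp.
    rewrite (leq_ltn_trans _ nN2) // -wn (leq_trans _ (leq_addl _ _)) //.
    by rewrite /weight (big_fsetD1 x) //= leq_addr.
  rewrite fsbig_finite // exchange_big /=; apply: eq_bigr => k _.
  by rewrite -big_distrr /= -fsbig_finite.
rewrite !Posz_sum -big_split /=; apply: eq_bigr => k _.
rewrite !PoszM Posz_sum -mulrDr; case: (posnP k) => [->|k0]; first by rewrite !mul0r.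
by rewrite (sum_distinct_parts_of_size r s k0 nN).
Qed.

Lemma nodds_weight (n N : nat) : (n < N)%N ->
  n%:Z * (nodds r s n)%:Z = \sum_(k < N) (k%:Z *
    ((0 < k)%:Z * (r%:Z * \sum_(i < N) (nodds r s (n%:Z - (i.+1 * k)%:Z))%:Z)
     + s%:Z * ((odd k)%:Z * \sum_(i < N) (nodds r s (n%:Z - (i.+1 * k)%:Z))%:Z))).
Proof.
move=> nN; have fin := @finite_odds r s n.
transitivity (((\big[addn/0]_(p \in @odds r s n) weight (p.1 : {mset cpart r}))
   + (\big[addn/0]_(p \in @odds r s n) weight (p.2 : {mset cpart s})))%N%:Z).
  rewrite -fsbig_split // -PoszM; congr (Posz _).
  rewrite /nodds /nmarked -[LHS]/(muln n _) fsbig_distrr //.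
  by apply: eq_fsbigr => p /set_mem [_ _ [<-]]; rewrite /= muln1.
rewrite PoszD (sum_weight_fst leq1_gt0 (@finite_odds r s) nN).
rewrite (sum_odds_snd _ _ (fun nu : {mset cpart s} => weight nu)).
rewrite (sum_weight_fst odd_gt0 (@finite_swapped_odds r s) nN).
rewrite !Posz_sum -big_split /=; apply: eq_bigr => k _.
rewrite !PoszM !Posz_sum -mulrDr; congr (_ * (_ + _)).
rewrite mulrCA; congr (_ * (_ * _)).
by apply: eq_bigr => i _; rewrite nswapped_odds.
Qed.

(* Comparing [n * novers n] with [n * nodds n] amounts to comparing the
   logarithmic derivatives of the two generating functions. *)
Lemma novers_nodds (m : int) : novers r s m = nodds r s m.
Proof.
case: m => n; last by rewrite novers_lt0 ?nodds_lt0.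
elim/ltn_ind: n => n IH.
case: (posnP n) => [->|n0]; first by rewrite novers0 nodds0.
(* All indices in the recurrences with [k > 0] lie below [n]: the induction hypothesis applies, or
   both counts are 0. *)
have E k i : (0 < k)%N ->
    novers r s (n%:Z - (i.+1 * k)%:Z) = nodds r s (n%:Z - (i.+1 * k)%:Z).
  move=> k0; have : n%:Z - (i.+1 * k)%:Z < n by nia.
  by case: (n%:Z - (i.+1 * k)%:Z) => m mn; [exact: IH | rewrite novers_lt0 ?nodds_lt0].
suff : n%:Z * (novers r s n)%:Z = n%:Z * (nodds r s n)%:Z.
  have nz : n%:Z != 0 by lia.
  by move=> /(mulfI nz) [].
(* The bound [n.+1.*2] gives both recurrences the same range of sizes. *)
rewrite (novers_weight (ltnSn n)) (@nodds_weight n n.+1.*2); last by lia.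
under eq_bigr do rewrite mulrDr.
under [RHS]eq_bigr do rewrite mulrDr.
rewrite !big_split /=; congr (_ + _).
  apply: eq_bigr => k _; case: (posnP k) => [->|k0]; first by rewrite !mul0r.
  by do 3 congr (_ * _); apply: eq_bigr => i _; rewrite E.
under eq_bigr do rewrite mulrCA.
under [RHS]eq_bigr do rewrite mulrCA.
rewrite -!mulr_sumr; congr (_ * _).
rewrite (@alternating_divisor_sum (fun m => (novers r s (n%:Z - m%:Z))%:Z)).
  apply: eq_bigr => k _; case: (posnP k) => [->|k0]; first by rewrite !mul0r.
  by do 2 congr (_ * _); apply: eq_bigr => i _; rewrite E.
by move=> m nm; rewrite novers_lt0 //; lia.
Qed.

End Euler.

(** * The three identities *)

(** In [sum_parts_repeated] only the odd sizes [i.*2.+1] survive. The formula also covers [m <= 0],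
    where the convention for [Gok] agrees with negative weights counting nothing. *)
Lemma GokE (r s k N : nat) (m : int) : (0 < k)%N -> (m <= N.*2%:Z) ->
  (Gok r s k m)%:Z
  = s%:Z * \sum_(i < N) (nodds r s (m - (i.*2.+1 * k)%:Z))%:Z.
Proof.
move=> k0 mN.
have G0 : m <= 0 -> s%:Z * \sum_(i < N) (nodds r s (m - (i.*2.+1 * k)%:Z))%:Z = 0.
  by move=> m0; rewrite big1 ?mulr0 // => i _; rewrite nodds_lt0 //; nia.
case: m mN G0 => [[|n]|n] mN G0; [by rewrite G0| |by rewrite G0].
rewrite /Gok colored_odd_overlined_partitionsE.
rewrite (sum_odds_snd _ _ (fun nu : {mset cpart s} => parts_repeated k nu)).
rewrite (sum_parts_repeated odd_gt0 (@finite_swapped_odds r s) (N := N.*2) k0);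
  last by lia.
rewrite PoszM Posz_sum; congr (_ * _).
rewrite (big_ord_double N (fun j =>
  (odd j.+1 * nmarked s odd _ _ (n.+1%:Z - (k * j.+1)%N%:Z))%N%:Z)).
apply: eq_bigr => i _.
by rewrite /= odd_double /= mul1n mul0n addr0 nswapped_odds mulnC.
Qed.

Theorem theorem7 (r s : nat) (r_gt0 : (0 < r)%N) (s_gt0 : (0 < s)%N)
    (n : nat) (n_gt0 : (0 < n)%N) :
  [/\ (forall k : nat, (0 < k)%N -> Fk r s k n = Gk r s k n),
      (forall k : nat, (0 < k)%N ->
         ((Fdk r s k n)%:Z = (Gok r s k n%:Z)%:Z - (Gok r s k (n%:Z - k%:Z))%:Z)%R)
    & (forall k : nat, odd k ->
         ((Fok r s k n)%:Z = (Gok r s k n%:Z)%:Z + (Gok r s k (n%:Z - k%:Z))%:Z)%R)].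
Proof.
(* Shifting by [k] turns the odd multiples in G^o_k into the even ones. *)
have shift (k i : nat) : n%:Z - k%:Z - (i.*2.+1 * k)%:Z = n%:Z - (i.*2.+2 * k)%:Z by lia.
split=> k k0.
- rewrite /Fk /Gk colored_overpartitionsE.
  rewrite (sum_parts_of_size leq1_gt0 (@finite_overs r s) k (leqnn n)) k0 mul1n.
  rewrite (sum_parts_repeated leq1_gt0 (@finite_overs r s) k0 (leqnn n)).
  by congr muln; apply: eq_bigr => i _; rewrite mul1n mulnC.
- rewrite /Fdk colored_overpartitionsE (sum_distinct_parts_of_size r s k0 (ltnSn n)).
  rewrite !(@GokE r s k n.+1 _ k0); [|lia|lia].
  rewrite -mulrBr -sumrB; congr (_ * _).
  by apply: eq_bigr => i _; rewrite shift !novers_nodds.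
- have k_gt0 := odd_gt0 k0; have n2 : (n <= n.*2)%N by lia.
  rewrite /Fok colored_odd_overlined_partitionsE.
  rewrite (sum_odds_snd _ _ (fun nu : {mset cpart s} => parts_of_size k nu)).
  rewrite (sum_parts_of_size odd_gt0 (@finite_swapped_odds r s) k n2).
  rewrite k0 mul1n PoszM Posz_sum !(@GokE r s k n _ k_gt0); [|lia|lia].
  rewrite -mulrDr -big_split /=; congr (_ * _).
  (* All multiples of [k] occur here with sign plus; separating odd from even ones gives the two
     values of G^o_k. *)
  rewrite (big_ord_double n (fun i => (nmarked s odd _ _ (n%:Z - (i.+1 * k)%N%:Z))%:Z)).
  by apply: eq_bigr => i _; rewrite shift !nswapped_odds.
Qed.
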